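(* (a) $\mathbb{Q}$ is not weakly uniserial as a $\mathbb{Z}$-module. (b) If $M$ is a $\mathbb{Z}$-module which is not torsion, then $M_{(0)}$ (the localization of $M$ at the prime ideal $(0)$ of $\mathbb{Z}$) is not weakly uniserial as a $\mathbb{Z}$-module.
   Context: A module $M$ is called weakly uniserial if for any two submodules $N$ and $K$ of $M$ there exists an injective module homomorphism $N\to K$ or an injective module homomorphism $K\to N$. A $\mathbb{Z}$-module $M$ is torsion if for every $m\in M$ there is a nonzero integer $n$ with $nm=0$. *)

(* Defs.v *)
From HB Require Import structures.
From mathcomp Require Import all_boot all_order all_algebra.
From mathcomp Require Import generic_quotient ring_quotient.
From mathcomp Require Import boolp ring.

Set Implicit Arguments.
Unset Strict Implicit.
Unset Printing Implicit Defensive.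

Import GRing.Theory.
Local Open Scope ring_scope.
Local Open Scope quotient_scope.

(* Membership in [N : submodClosed M] is boolean; since [boolp.asbool] turns
   every Prop-valued predicate into a boolean one, no submodule is left out. *)
Definition submodule (R : nzRingType) (M : lmodType R) (N : submodClosed M) :=
  {x : M | x \in N}.

Section SubmoduleInstances.
Variables (R : nzRingType) (M : lmodType R) (N : submodClosed M).

HB.instance Definition _ := [isSub of submodule N for @sval _ _].
HB.instance Definition _ := [Choice of submodule N by <:].
HB.instance Definition _ := [SubChoice_isSubLmodule of submodule N by <:].

End SubmoduleInstances.

Definition embeds (R : nzRingType) (U V : lmodType R) : Prop :=
  exists f : {linear U -> V}, injective f.

Definition weakly_uniserial (R : nzRingType) (M : lmodType R) : Prop :=
  forall N K : submodClosed M,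
    embeds (submodule N) (submodule K) \/ embeds (submodule K) (submodule N).

Definition torsion (M : lmodType int) : Prop :=
  forall m : M, exists2 n : int, n != 0 & n *: m = 0.

Section Localization.
Variables (R : comNzRingType) (p : prime_idealr R).

Definition denominator := {s : R | s \notin p}.

HB.instance Definition _ := Choice.on denominator.

Fact denom1_subproof : 1 \notin p. Proof. by rewrite idealr1. Qed.

Fact denomM_subproof (s t : denominator) : sval s * sval t \notin p.
Proof. by rewrite prime_idealrM negb_or (svalP s) (svalP t). Qed.

Definition denom1 : denominator := exist _ 1 denom1_subproof.
Definition denomM (s t : denominator) : denominator :=
  exist _ (sval s * sval t) (denomM_subproof s t).

Variable M : lmodType R.

(* The factor t is needed because M may have torsion. *)
Definition loc_equiv (x y : M * denominator) : bool :=
  `[< exists t : denominator,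
        sval t *: (sval y.2 *: x.1) = sval t *: (sval x.2 *: y.1) >].

Lemma loc_equiv_refl : reflexive loc_equiv.
Proof. by move=> x; apply/asboolP; exists denom1. Qed.

Lemma loc_equiv_sym : symmetric loc_equiv.
Proof. by move=> x y; apply/asboolP/asboolP => -[t ht]; exists t. Qed.

Lemma loc_equiv_trans : transitive loc_equiv.
Proof.
move=> [y r] [x s] [z u] /asboolP[t /= ht] /asboolP[v /= hv].
apply/asboolP; exists (denomM r (denomM t v)) => /=.
transitivity ((sval v * sval u) *: (sval t *: (sval r *: x))).
  by rewrite !scalerA; congr (_ *: _); ring.
rewrite ht; transitivity ((sval t * sval s) *: (sval v *: (sval u *: y))).
  by rewrite !scalerA; congr (_ *: _); ring.
by rewrite hv !scalerA; congr (_ *: _); ring.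
Qed.

Canonical loc_equiv_equiv :=
  EquivRel loc_equiv loc_equiv_refl loc_equiv_sym loc_equiv_trans.

Definition localization := {eq_quot loc_equiv}.

HB.instance Definition _ : EqQuotient _ loc_equiv localization :=
  EqQuotient.on localization.
HB.instance Definition _ := Choice.on localization.

Definition loc_frac (m : M) (s : denominator) : localization :=
  \pi_localization (m, s).

Lemma loc_fracP m s n t : loc_frac m s = loc_frac n t <->
  exists u : denominator, sval u *: (sval t *: m) = sval u *: (sval s *: n).
Proof.
by split=> [/eqmodP/asboolP //|h]; apply/eqmodP/asboolP.
Qed.

Lemma loc_fracW (P : localization -> Prop) :
  (forall m s, P (loc_frac m s)) -> forall x, P x.
Proof. by move=> h; elim/quotW=> -[m s]; apply: h. Qed.

Lemma loc_frac_repr x : loc_frac (repr x).1 (repr x).2 = x.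
Proof. by rewrite /loc_frac -surjective_pairing reprK. Qed.

Definition loc_zero : localization := loc_frac 0 denom1.

Definition loc_opp (x : localization) : localization :=
  loc_frac (- (repr x).1) (repr x).2.

Definition loc_add (x y : localization) : localization :=
  loc_frac (sval (repr y).2 *: (repr x).1 + sval (repr x).2 *: (repr y).1)
           (denomM (repr x).2 (repr y).2).

Definition loc_scale (a : R) (x : localization) : localization :=
  loc_frac (a *: (repr x).1) (repr x).2.

Lemma loc_oppE m s : loc_opp (loc_frac m s) = loc_frac (- m) s.
Proof.
have /loc_fracP[u hu] := loc_frac_repr (loc_frac m s).
by apply/loc_fracP; exists u; rewrite !scalerN hu.
Qed.

Lemma loc_scaleE a m s : loc_scale a (loc_frac m s) = loc_frac (a *: m) s.
Proof.
have /loc_fracP[u hu] := loc_frac_repr (loc_frac m s).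
apply/loc_fracP; exists u.
move: (repr _) hu => [n t] /= hu.
transitivity (a *: (sval u *: (sval s *: n))).
  by rewrite !scalerA; congr (_ *: _); ring.
by rewrite hu !scalerA; congr (_ *: _); ring.
Qed.

Lemma loc_addE m s n t : loc_add (loc_frac m s) (loc_frac n t) =
  loc_frac (sval t *: m + sval s *: n) (denomM s t).
Proof.
have /loc_fracP[u hu] := loc_frac_repr (loc_frac m s).
have /loc_fracP[v hv] := loc_frac_repr (loc_frac n t).
rewrite /loc_add; case: (repr (loc_frac m s)) hu => [m' s'] /= hu.
case: (repr (loc_frac n t)) hv => [n' t'] /= hv.
apply/loc_fracP; exists (denomM u v) => /=; rewrite !scalerDr; congr (_ + _).
  transitivity ((sval v * sval t * sval t') *: (sval u *: (sval s *: m'))).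
    by rewrite !scalerA; congr (_ *: _); ring.
  by rewrite hu !scalerA; congr (_ *: _); ring.
transitivity ((sval u * sval s * sval s') *: (sval v *: (sval t *: n'))).
  by rewrite !scalerA; congr (_ *: _); ring.
by rewrite hv !scalerA; congr (_ *: _); ring.
Qed.

Lemma loc_addA : associative loc_add.
Proof.
elim/loc_fracW=> x s; elim/loc_fracW=> y t; elim/loc_fracW=> z u.
rewrite !loc_addE; apply/loc_fracP; exists denom1.
rewrite /= !scalerDr !scalerA addrA.
by congr (_ *: _ + _ *: _ + _ *: _); ring.
Qed.

Lemma loc_addC : commutative loc_add.
Proof.
elim/loc_fracW=> x s; elim/loc_fracW=> y t.
rewrite !loc_addE; apply/loc_fracP; exists denom1.
rewrite /= !scalerDr !scalerA addrC.
by congr (_ *: _ + _ *: _); ring.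
Qed.

Lemma loc_add0 : left_id loc_zero loc_add.
Proof.
elim/loc_fracW=> x s; rewrite loc_addE; apply/loc_fracP; exists denom1.
by rewrite /= scaler0 add0r !scalerA; congr (_ *: _); ring.
Qed.

Lemma loc_addN : left_inverse loc_zero loc_opp loc_add.
Proof.
elim/loc_fracW=> x s; rewrite loc_oppE loc_addE; apply/loc_fracP; exists denom1.
by rewrite /= scalerN addNr !scaler0.
Qed.

HB.instance Definition _ :=
  GRing.isZmodule.Build localization loc_addA loc_addC loc_add0 loc_addN.

Lemma loc_scaleA a b x : loc_scale a (loc_scale b x) = loc_scale (a * b) x.
Proof. by elim/loc_fracW: x => m s; rewrite !loc_scaleE scalerA. Qed.

Lemma loc_scale1 : left_id 1 loc_scale.
Proof. by elim/loc_fracW=> m s; rewrite loc_scaleE scale1r. Qed.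

Lemma loc_scaleDr : right_distributive loc_scale +%R.
Proof.
move=> a; elim/loc_fracW=> m s; elim/loc_fracW=> n t.
rewrite [loc_frac m s + _]loc_addE !loc_scaleE [RHS]loc_addE.
by rewrite scalerDr !scalerA ![a * _]mulrC.
Qed.

Lemma loc_scaleDl x : {morph loc_scale^~ x : a b / a + b}.
Proof.
move=> a b; elim/loc_fracW: x => m s; rewrite !loc_scaleE [RHS]loc_addE.
apply/loc_fracP; exists denom1.
by rewrite /= scalerDl !scalerDr !scalerA; congr (_ *: _ + _ *: _); ring.
Qed.

HB.instance Definition _ := GRing.Zmodule_isLmodule.Build R localization
  loc_scaleA loc_scale1 loc_scaleDr loc_scaleDl.

End Localization.

Definition zero_ideal (R : idomainType) (x : R) : bool := x == 0.

Fact zero_ideal_closed (R : idomainType) : idealr_closed (@zero_ideal R).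
Proof.
split; rewrite ?unfold_in ?eqxx ?oner_eq0 // => a u v.
by rewrite !unfold_in => /eqP-> /eqP->; rewrite mulr0 addr0.
Qed.

Fact zero_ideal_prime (R : idomainType) :
  prime_idealr_closed (@zero_ideal R).
Proof. by move=> u v; rewrite !unfold_in mulf_eq0. Qed.

HB.instance Definition _ (R : idomainType) :=
  isIdealr.Build R (@zero_ideal R) (@zero_ideal_closed R).
HB.instance Definition _ (R : idomainType) :=
  isPrimeIdealrClosed.Build R (@zero_ideal R) (@zero_ideal_prime R).

(* Main.v *)
(** The elements [x] with [p ^+ k *: x] a multiple of a fixed [v != 0] form a
    copy of Z[1/p] inside a torsion-free divisible module.  An embedding of
    Z[1/p] into Z[1/q], with p and q coprime, would send [v] to a nonzero element
    infinitely divisible by p, and Z[1/q] has none; take p = 2 and q = 3. *)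

Require Import Defs.
From mathcomp Require Import all_boot all_order all_algebra.
From HB Require Import structures.
From mathcomp Require Import boolp ring.

Set Implicit Arguments.
Unset Strict Implicit.
Unset Printing Implicit Defensive.

Import Order.TTheory GRing.Theory Num.Theory.
Local Open Scope ring_scope.

Definition multiple_span (V : lmodType int) (v : V) (p : int) : {pred V} :=
  fun x => `[< exists k a, p ^+ k *: x = a *: v >].

Fact multiple_span_closed (V : lmodType int) (v : V) (p : int) :
  submod_closed (multiple_span v p).
Proof.
split; first by apply/asboolP; exists 0%N, 0; rewrite scaler0 scale0r.
move=> c x y /asboolP[k [a hx]] /asboolP[l [b hy]]; apply/asboolP.
exists (k + l)%N, (p ^+ l * c * a + p ^+ k * b).
rewrite scalerDr scalerDl -!scalerA -hx -hy !scalerA exprD.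
by congr (_ *: _ + _ *: _); ring.
Qed.

HB.instance Definition _ (V : lmodType int) (v : V) (p : int) :=
  GRing.isSubmodClosed.Build int V (multiple_span v p)
    (multiple_span_closed v p).

(** A nonzero [a] satisfies [|a| < |p| ^ |a|], so the exponent [|a|] already rules out
    divisibility. *)
Lemma dvdz_expn_eq0 (p a : int) :
  (1 < `|p|)%N -> (forall n, (p ^+ n %| a)%Z) -> a = 0.
Proof.
move=> p_gt1 pdva; apply/eqP/negPn/negP => a0.
have := pdva `|a|%N; rewrite dvdzE abszX => /dvdn_leq.
by rewrite absz_gt0 leqNgt ltn_expl // => /(_ a0).
Qed.

Section TorsionFree.
Variables (V : lmodType int) (v : V).
Hypothesis tfV : forall (n : int) (x : V), n *: x = 0 -> n = 0 \/ x = 0.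
Hypothesis v_neq0 : v <> 0.

Lemma scale_intI (a b : int) : a *: v = b *: v -> a = b.
Proof.
move=> /eqP; rewrite -subr_eq0 -scalerBl => /eqP/tfV[/eqP|//].
by rewrite subr_eq0 => /eqP.
Qed.

(** Write [q ^+ k *: x = a *: v]. Clearing powers of [q] in [x = p ^+ n *: y] and comparing
    coefficients of [v] shows that [p ^+ n] divides [a] times a power of [q]. By coprimality it
    divides [a], for every [n]. *)
Lemma multiple_span_divisible_eq0 (p q : int) (x : V) :
    (1 < `|p|)%N -> coprimez p q -> q != 0 -> x \in multiple_span v q ->
  (forall n, exists2 y, y \in multiple_span v q & x = p ^+ n *: y) -> x = 0.
Proof.
move=> p_gt1 cpq q0 /asboolP[k [a hx]] divx.
suff a0 : a = 0.
  move: hx; rewrite a0 scale0r => /tfV[/eqP|//].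
  by rewrite expf_eq0 (negPf q0) andbF.
apply: (dvdz_expn_eq0 p_gt1) => n.
have [y /asboolP[l [b hy]] xE] := divx n.
have /scale_intI aE : (a * q ^+ l) *: v = (p ^+ n * (q ^+ k * b)) *: v.
  transitivity (q ^+ l *: (a *: v)); first by rewrite scalerA mulrC.
  transitivity ((p ^+ n * q ^+ k) *: (b *: v)); last by rewrite scalerA mulrA.
  by rewrite -hx -hy xE !scalerA; congr (_ *: _); ring.
have : (p ^+ n %| a * q ^+ l)%Z by rewrite aE dvdz_mulr.
by rewrite Gauss_dvdzl // coprimezXl // coprimezXr.
Qed.

Hypothesis divv : forall n : int, n != 0 -> exists y, n *: y = v.

Lemma multiple_span_not_embeds (p q : int) :
    (1 < `|p|)%N -> coprimez p q -> q != 0 ->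
  ~ embeds (submodule (multiple_span v p)) (submodule (multiple_span v q)).
Proof.
move=> p_gt1 cpq q0 [f f_inj].
have p0 : p != 0 by rewrite -absz_gt0 ltnW.
have vP : v \in multiple_span v p by apply/asboolP; exists 0%N, 1.
pose w : submodule (multiple_span v p) := Sub v vP.
(* The equation is moved into [V], where the divisibility lemma applies; injectivity of [f] then
   gives [v = 0]. *)
suff /val_inj fw0 : val (f w) = val (0 : submodule (multiple_span v q)).
  apply: v_neq0.
  by have /(congr1 val) := f_inj w 0 (etrans fw0 (esym (linear0 f))).
apply: (multiple_span_divisible_eq0 p_gt1 cpq q0 (valP (f w))) => n.
have [y hy] := divv (expf_neq0 n p0).
(* The quotient of [v] by [p ^+ n] lies in the span itself, so [f] carries the divisibility over to
   [f w]. *)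
have yP : y \in multiple_span v p
    by apply/asboolP; exists n, 1; rewrite hy scale1r.
exists (val (f (Sub y yP))); first exact: valP.
suff -> : w = p ^+ n *: (Sub y yP : submodule (multiple_span v p)).
  by rewrite linearZ.
exact/val_inj/esym.
Qed.

Lemma torsion_free_not_weakly_uniserial : ~ weakly_uniserial V.
Proof.
(* Coprimality is symmetric, so the same lemma refutes both directions. *)
by move=> /(_ (multiple_span v 2) (multiple_span v 3))[];
  apply: multiple_span_not_embeds.
Qed.

End TorsionFree.

Lemma localization0_torsion_free (M : lmodType int) (n : int)
    (x : localization (@zero_ideal int) M) : n *: x = 0 -> n = 0 \/ x = 0.
Proof.
have [->|n0] := eqVneq n 0; first by left.
elim/loc_fracW: x => m s; rewrite [_ *: _]loc_scaleE => /loc_fracP[u /= hu].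
right; apply/loc_fracP.
(* Away from the ideal 0, [n] is itself a denominator, so the witness can absorb it. *)
exists (denomM u (exist (fun s => s \notin @zero_ideal int) n n0)) => /=.
by move: hu; rewrite !scaler0 !scale1r scalerA.
Qed.

Theorem corollary2p16 :
  ~ weakly_uniserial (zmodule rat : lmodType int) /\
  (forall M : lmodType int, ~ torsion M ->
     ~ weakly_uniserial (localization (@zero_ideal int) M : lmodType int)).
Proof.
split.
  apply: (@torsion_free_not_weakly_uniserial (zmodule rat) (1 : rat)) => //.
  - move=> n x /eqP; rewrite [_ *: _]scalezrE mulrz_eq0.
    by case/orP => /eqP; [left | right].
  - move=> n n0; exists (n%:~R^-1 : rat).
    by rewrite [_ *: _]scalezrE -mulrzl mulfV ?intr_eq0.
move=> M /existsNP[m mP].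
(* No nonzero integer kills [m], so [m/1] is nonzero; its quotient by [n] is [m/n]. *)
apply: (@torsion_free_not_weakly_uniserial _ (loc_frac m (denom1 _))).
- exact: localization0_torsion_free.
- move=> /loc_fracP[u /=]; rewrite scale1r !scaler0 => um0.
  by apply: mP; exists (sval u); first exact: (svalP u).
- move=> n n0.
  exists (loc_frac m (exist (fun s => s \notin @zero_ideal int) n n0)).
  rewrite [_ *: _]loc_scaleE; apply/loc_fracP; exists (denom1 _) => /=.
  by rewrite !scale1r.
Qed.
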